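(* Consider the Gamma–Poisson network model with $N$ agents and an additional agent $j$ not participating in the computation of $\hat b^{\mathrm{ML}}$, and let $\hat\lambda^{\mathrm{EB}}_j=\frac{\hat b^{\mathrm{ML}}}{\hat b^{\mathrm{ML}}n_j+1}(a+\sigma_j)$ be the (steady-state) Empirical Bayes estimator of $\lambda_j$. Then, as $N\to\infty$, $$\mathrm{E}[\hat\lambda^{\mathrm{EB}}_j\mid\lambda_j]\longrightarrow\frac{b}{1+n_jb}(a+n_j\lambda_j)$$ to second order, and $$\mathrm{VAR}[\hat\lambda^{\mathrm{EB}}_j\mid\lambda_j]\longrightarrow\left(\frac{b}{1+n_jb}\right)^2n_j\lambda_j$$ to first order. Here ''to second order'' and ''to first order'' mean that the Taylor approximations $\mathcal{E}_N$ of the conditional mean and $\mathcal{V}_N$ of the conditional variance defined in the context converge to the indicated limits.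
   Context: Model. Fix $a>0$ (known shape), $b>0$ (true unknown scale, deterministic), and an integer $n_{\max}\ge 1$. For each $N$ there are agents $1,\dots,N$, with (deterministic) sample sizes $n_i\in\{1,\dots,n_{\max}\}$, and one further agent labelled $j$ with fixed sample size $n_j\in\{1,\dots,n_{\max}\}$. The rates $\lambda_i$ (of all agents, including $j$) are i.i.d. $\mathrm{Gamma}(a,b)$ with density $\lambda^{a-1}e^{-\lambda/b}/(\Gamma(a)b^a)$ on $(0,\infty)$. Conditionally on the rates, all measurements $y_{i,\ell}$, $\ell=1,\dots,n_i$, are independent with $y_{i,\ell}\sim\mathrm{Poisson}(\lambda_i)$. Put $\sigma_i=\sum_{\ell=1}^{n_i}y_{i,\ell}$ (also for $i=j$). $\hat b^{\mathrm{ML}}=\hat b^{\mathrm{ML}}_N$ is the maximum likelihood estimator of $b$ based on agents $1,\dots,N$ only (agent $j$ excluded, so $\hat b^{\mathrm{ML}}$ is independent of $(\lambda_j,\sigma_j)$): the minimizer over $b\in\mathbb{R}_+$ of $$aN\log b-\sum_{i=1}^N(\sigma_i+a)\log\!\left(\frac{b}{n_ib+1}\right),$$ with the value $\hat b^{\mathrm{ML}}=0$ when $\sigma_1=\dots=\sigma_N=0$ (the objective being extended to $b=0$ by continuity). Taylor approximations. Write $\hat\lambda^{\mathrm{EB}}_j=Z(\hat b^{\mathrm{ML}})\,Y$ with $Z(s)=\frac{s}{1+n_js}$ and $Y=a+\sigma_j$. Conditionally on $\lambda_j$, $\mathrm{E}[Y\mid\lambda_j]=a+n_j\lambda_j$ and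 $\mathrm{VAR}[Y\mid\lambda_j]=n_j\lambda_j$. With $m_N=\mathrm{E}[\hat b^{\mathrm{ML}}]$ and $v_N=\mathrm{VAR}[\hat b^{\mathrm{ML}}]$, expanding $Z$ around $m_N$, the second-order approximation of $\mathrm{E}[Z(\hat b^{\mathrm{ML}})]$ is $M_N=Z(m_N)+\tfrac12Z''(m_N)v_N$ and the first-order approximation of $\mathrm{VAR}[Z(\hat b^{\mathrm{ML}})]$ is $(Z'(m_N))^2v_N$. The second-order approximation of the conditional mean of $\hat\lambda^{\mathrm{EB}}_j$ is $$\mathcal{E}_N=M_N\,(a+n_j\lambda_j).$$ The first-order approximation of the conditional variance uses only the first-order expansion of $Z$ around $m_N$, for which the mean of $Z(\hat b^{\mathrm{ML}})$ is $Z(m_N)$: $$\mathcal{V}_N=Z(m_N)^2\,n_j\lambda_j+(Z'(m_N))^2v_N\big[(a+n_j\lambda_j)^2+n_j\lambda_j\big].$$ *)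

(* Defs.v *)
From HB Require Import structures.
From mathcomp Require Import all_boot all_order all_algebra.
From mathcomp Require Import all_classical all_reals all_analysis.

Set Implicit Arguments.
Unset Strict Implicit.
Unset Printing Implicit Defensive.

Import Order.TTheory GRing.Theory Num.Theory.
Import numFieldNormedType.Exports.

Local Open Scope classical_set_scope.
Local Open Scope ring_scope.

Definition Gamma_fun {R : realType} (a : R) : R :=
  fine (\int[lebesgue_measure]_(x in `]0%R, +oo[) (x `^ (a - 1) * expR (- x))%:E).

(* Shape [a], scale [b]. *)
Definition gamma_pdf {R : realType} (a b x : R) : R :=
  if 0 < x then x `^ (a - 1) * expR (- x / b) / (Gamma_fun a * b `^ a) else 0.

Definition has_gamma_law {d} {T : measurableType d} {R : realType}
    (P : probability T R) (a b : R) (X : {RV P >-> R}) : Prop :=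
  forall A : set R, measurable A ->
    distribution P X A = (\int[lebesgue_measure]_(x in A) (gamma_pdf a b x)%:E)%E.

Definition mutually_independent {d} {T : measurableType d} {R : realType}
    (P : probability T R) (I : eqType) (X : I -> {RV P >-> R}) : Prop :=
  forall (F : seq I) (B : I -> set R), uniq F -> (forall i, measurable (B i)) ->
    P [set w | forall i, i \in F -> B i (X i w)]
    = (\prod_(i <- F) P (X i @^-1` B i))%E.

Definition generated_sigma {d} {T : measurableType d} {R : realType}
    (P : probability T R) (I : Type) (X : I -> {RV P >-> R}) : set (set T) :=
  <<s \bigcup_(i in [set: I]) preimage_set_system setT (X i) measurable >>.

(* [f] is a version of the conditional probability of the event [E] given the
   sub-sigma-algebra [G]. *)
Definition is_cond_prob {d} {T : measurableType d} {R : realType}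
    (P : probability T R) (G : set (set T)) (E : set T) (f : T -> R) : Prop :=
  [/\ forall B : set R, measurable B -> G (f @^-1` B),
      P.-integrable setT (EFin \o f) &
      forall A : set T, G A -> (\int[P]_(w in A) (f w)%:E = P (A `&` E))%E].

(* The agents are indexed by [option nat]: [Some i] is the agent number [i.+1]
   of the network (so that the agents 1, ..., N are [Some i] for [i < N]) and
   [None] is the additional agent j.  Only the measurements [y i l] with
   [l < n i] are part of the model. *)
Record gamma_poisson_model {d} {T : measurableType d} {R : realType}
    (P : probability T R) (a b : R) (n : option nat -> nat)
    (rate : option nat -> {RV P >-> R})
    (y : option nat -> nat -> {RV P >-> nat}) : Prop := GammaPoissonModel {
  rate_law : forall i, has_gamma_law a b (rate i) ;
  rate_indep : mutually_independent rate ;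
  (* Given all the rates, the measurements are independent and Poisson: finite
     families have a product of Poisson mass functions as joint conditional
     law. *)
  measurement_law : forall (F : seq (option nat * nat))
      (k : option nat * nat -> nat),
    uniq F -> (forall p, p \in F -> (p.2 < n p.1)%N) ->
    is_cond_prob P (generated_sigma rate)
      [set w | forall p, p \in F -> y p.1 p.2 w = k p]
      (fun w => \prod_(p <- F) poisson_pmf (rate p.1 w) (k p)) }.

Definition total_count {T : Type} (n : option nat -> nat)
    (y : option nat -> nat -> T -> nat) (i : option nat) (w : T) : nat :=
  (\sum_(l < n i) y i l w)%N.

Definition ml_objective {R : realType} (a : R) (N : nat)
    (n s : option nat -> nat) (b : R) : R :=
  a * N%:R * ln b -
  \sum_(i < N) ((s (Some (i : nat)))%:R + a) *
               ln (b / ((n (Some (i : nat)))%:R * b + 1)).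

(* Extension to [b = 0] by continuity; the limit is [+oo] unless all counts
   vanish. *)
Definition ml_objective_ext {R : realType} (a : R) (N : nat)
    (n s : option nat -> nat) (b : R) : \bar R :=
  if b == 0 then lim ((ml_objective a N n s t)%:E @[t --> (0 : R)^'+])
  else (ml_objective a N n s b)%:E.

(* [x] minimizes the objective over [0, +oo[, with value 0 when all counts
   vanish. *)
Definition is_ml_estimate {R : realType} (a : R) (N : nat)
    (n s : option nat -> nat) (x : R) : Prop :=
  [/\ 0 <= x,
      forall t : R, 0 <= t ->
        (ml_objective_ext a N n s x <= ml_objective_ext a N n s t)%E &
      (forall i, (i < N)%N -> s (Some i) = 0%N) -> x = 0].

(* The Empirical Bayes estimator of the rate of agent j is
   [eb_factor nj bhat * (a + sigma_j)]. *)
Definition eb_factor {R : realType} (nj : nat) (s : R) : R :=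
  s / (1 + nj%:R * s).

Section Taylor.
Context {d} {T : measurableType d} {R : realType} (P : probability T R).

Definition mean (X : T -> R) : R := fine ('E_P[X])%E.
Definition var (X : T -> R) : R := fine (variance P X).

Definition taylor2_mean (f : R -> R) (X : T -> R) : R :=
  f (mean X) + 2^-1 * derive1n 2 f (mean X) * var X.

Definition taylor1_mean (f : R -> R) (X : T -> R) : R := f (mean X).

Definition taylor1_var (f : R -> R) (X : T -> R) : R :=
  (derive1 f (mean X)) ^+ 2 * var X.

(* Conditional mean and variance, given the rate [lam] of agent j, of
   [Y = a + sigma_j], where [sigma_j] is Poisson of parameter [nj * lam]. *)
Definition shifted_count_mean (a : R) (nj : nat) (lam : R) : R :=
  a + nj%:R * lam.
Definition shifted_count_var (nj : nat) (lam : R) : R := nj%:R * lam.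

Definition eb_mean_approx (a : R) (nj : nat) (bhat : T -> R) (lam : R) : R :=
  taylor2_mean (eb_factor nj) bhat * shifted_count_mean a nj lam.

(* For independent Z and Y,
   VAR[Z Y] = E[Z]^2 VAR[Y] + VAR[Z] (E[Y]^2 + VAR[Y]). *)
Definition eb_var_approx (a : R) (nj : nat) (bhat : T -> R) (lam : R) : R :=
  taylor1_mean (eb_factor nj) bhat ^+ 2 * shifted_count_var nj lam +
  taylor1_var (eb_factor nj) bhat *
    (shifted_count_mean a nj lam ^+ 2 + shifted_count_var nj lam).

End Taylor.

(* Main.v *)
Require Import Defs.
From HB Require Import structures.
From mathcomp Require Import all_boot all_order all_algebra.
From mathcomp Require Import all_classical all_reals all_analysis.
From mathcomp Require Import measurable_realfun ring lra zify.

Set Implicit Arguments.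
Unset Strict Implicit.
Unset Printing Implicit Defensive.

Import Order.TTheory GRing.Theory Num.Theory.
Import numFieldNormedType.Exports.

Local Open Scope classical_set_scope.
Local Open Scope ring_scope.

(** For N >= 1 the maximum likelihood estimate is the root x >= 0 of the score
      sum_i (sigma_i - a n_i x) / (n_i x + 1)
    ([ml_estimate_score]), and E sigma_i = a n_i b, so that b is the root of
    the expected score.  The whole proof rests on the mean-square rate
    E (bML_N - b)^2 <= K / N ([bML_mean_square]): since
    E (X - b)^2 = VAR X + (E X - b)^2, it gives at once that the mean of bML_N
    tends to b and that its variance tends to 0, and the Taylor approximations
    are continuous functions of these two numbers near (b, 0).

    The rate comes from a pointwise inequality ([score_root_deviation]).  Put
    D_i = sigma_i - a n_i b.  The score is monotone and, on bounded intervals,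
    its slope is at least of order N; hence, as long as x stays below a fixed
    multiple of b, N |x - b| is at most a constant times the score at b,
    |sum_i D_i / (n_i b + 1)|.  The slope degenerates for large x, and there
    another argument is used: x is a weighted average of the sigma_i / (a n_i)
    with weights whose ratios are at most n_max, so that x is at most n_max b
    plus a multiple of the average of the D_i / n_i; for x >= 2 n_max b that
    multiple is at least x / 2.  In both cases N^2 (x - b)^2 is at most
    a constant times the square of a weighted sum of the D_i with weights at
    most 1.

    It remains that such sums have variance O(N) ([weighted_deviation_sqr]).
    The measurements of different agents are uncorrelated, as their pair law
    is a product by conditional independence and independence of the rates
    ([measurement_pair_pmf]), and their second moments are those of
    a Gamma mixture of Poisson laws.  The Poisson moments come from
    k pmf(r, k) = r pmf(r, k - 1) ([poisson_pmf_shift]), the Gamma moments from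
    an integration by parts ([integral_gamma_kernelS]) together with the fact
    that a law has total mass one. *)

(** * Integrals of Gamma densities *)

Section GammaIntegrals.
Context {R : realType}.
Implicit Types (b c x : R).

(** Written with exponent [c - 1] so that multiplication by [x ^+ k] turns
    the parameter [c] into [c + k]. *)
Definition gamma_kernel (b c x : R) : R := x `^ (c - 1) * expR (- x / b).

Lemma gamma_kernel_ge0 b c x : 0 <= gamma_kernel b c x.
Proof. by rewrite mulr_ge0// ?powR_ge0// expR_ge0. Qed.

Lemma measurable_gamma_kernel b c (D : set R) : measurable D ->
  measurable_fun D (gamma_kernel b c).
Proof.
move=> mD; apply: (measurable_funS measurableT) => //.
apply: measurable_funM; first exact: measurable_powR.
by apply: measurableT_comp => //; apply: measurable_funM.
Qed.

Lemma gamma_kernel_cvg0 b c : 0 < b -> 0 < c ->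
  gamma_kernel b (c + 1) n.+2%:R^-1 @[n --> \oo] --> 0.
Proof.
move=> b0 c0.
have h : (fun n => (n.+2%:R^-1 : R) `^ c) @ \oo --> 0.
  have /cvg_at_rightP := powR_cvg0 c0; apply; split => //.
  have := @cvg_harmonic R.
  by rewrite -(cvg_shiftS).
apply: (squeeze_cvgr _ (cvg_cst 0) h); near=> n.
rewrite gamma_kernel_ge0/= /gamma_kernel addrK ler_piMr// ?powR_ge0//.
by rewrite -[leRHS]expR0 ler_expR mulNr oppr_le0 mulr_ge0// ?invr_ge0// ltW.
Unshelve. all: by end_near. Qed.

(** The bound ln u < u at u = x / (2 b c) costs half of the exponential
    decay, which leaves the other half. *)
Lemma gamma_kernel_le b c x : 0 < b -> 0 < c -> 0 < x ->
  gamma_kernel b (c + 1) x <= (2 * b * c) `^ c * expR (- (x / (2 * b))).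
Proof.
move=> b0 c0 x0; have bc0 : 0 < 2 * b * c by rewrite !mulr_gt0.
have u0 : 0 < x / (2 * b * c) by rewrite divr_gt0.
rewrite /gamma_kernel addrK -{1}[x](mulfVK (lt0r_neq0 bc0)) (mulrC (x / _)).
rewrite (powRM _ (ltW bc0) (ltW u0)) -mulrA ler_wpM2l ?powR_ge0//.
rewrite {1}/powR gt_eqF// -expRD ler_expR.
have : c * ln (x / (2 * b * c)) <= c * (x / (2 * b * c)).
  by rewrite ler_wpM2l ?ltW// ln_sublinear.
have -> : c * (x / (2 * b * c)) = x / (2 * b) by field; rewrite !gt_eqF.
have -> : - x / b = - (x / (2 * b)) - (x / (2 * b)) by field; rewrite gt_eqF.
lra.
Qed.

Lemma gamma_kernel_cvgy b c : 0 < b -> 0 < c ->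
  gamma_kernel b (c + 1) n.+2%:R @[n --> \oo] --> 0.
Proof.
move=> b0 c0.
have k : (fun n => n.+2%:R / (2 * b) : R) @ \oo --> +oo.
  apply/cvgryPge => A; near=> n.
  rewrite ler_pdivlMr ?mulr_gt0// (@le_trans _ _ n%:R)// ?ler_nat; last by lia.
  by near: n; exact: nbhs_infty_ger.
have h : (fun n => (2 * b * c) `^ c * expR (- (n.+2%:R / (2 * b)))) @ \oo --> 0.
  rewrite -(mulr0 ((2 * b * c) `^ c)); apply: cvgMr.
  exact: (cvg_comp _ _ k (@cvgr_expR R)).
apply: (squeeze_cvgr _ (cvg_cst 0) h); near=> n.
by rewrite gamma_kernel_ge0/= gamma_kernel_le.
Unshelve. all: by end_near. Qed.

Local Notation mu := (@lebesgue_measure R).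

(** Integration by parts with the factors [x `^ c] and
    [- b * expR (- x / b)], away from the singularity at 0. *)
Lemma gamma_kernel_by_parts b c u v : 0 < b -> 0 < c -> 0 < u -> u < v ->
  (\int[mu]_(x in `[u, v]) (gamma_kernel b (c + 1) x)%:E =
   (b * (gamma_kernel b (c + 1) u - gamma_kernel b (c + 1) v))%:E +
   (b * c)%:E * \int[mu]_(x in `[u, v]) (gamma_kernel b c x)%:E)%E.
Proof.
move=> b0 c0 u0 uv.
have dF (x : R) : 0 < x -> is_derive x 1 (@powR R ^~ c) (c * x `^ (c - 1)).
  exact: is_derive1_powR.
have dG (x : R) : is_derive x 1 (fun x : R => - b * expR (- x / b)) (expR (- x / b)).
  have -> : expR (- x / b) = - b * (- b^-1 * expR (- x / b)).
    by rewrite mulrA mulrNN mulfV ?gt_eqF// mul1r.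
  apply: is_deriveZ; rewrite mulrC.
  apply: (@is_derive1_comp _ expR (fun x : R => - x / b)).
  have -> : (fun x : R => - x / b) = (- b^-1) \*: (id : R -> R).
    by apply/funext => z /=; rewrite /GRing.scale/= mulrC mulrN mulNr.
  rewrite -[X in is_derive _ _ _ X]mulr1.
  exact: (@is_deriveZ _ _ _ _ (- b^-1) _ _ _ (is_derive_id _ _)).
have itv_gt0 x : x \in `[u, v] -> 0 < x.
  by rewrite in_itv/= => /andP[ux _]; exact: lt_le_trans ux.
have powcx (r x : R) : 0 < x -> {for x, continuous (@powR R ^~ r)}.
  move=> x0; apply/differentiable_continuous/derivable1_diffP.
  by have [] := is_derive1_powR r x0.
have powc (r : R) : {within `[u, v], continuous (@powR R ^~ r)}.
  apply: continuous_in_subspaceT => x /[!inE] xuv.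
  exact/powcx/itv_gt0.
have contG : continuous (fun x : R => - b * expR (- x / b)).
  by move=> x; apply/differentiable_continuous/derivable1_diffP; have [] := dG x.
have parts := @integration_by_parts R (@powR R ^~ c) (fun x => - b * expR (- x / b))
  (fun x => c * x `^ (c - 1)) (fun x => expR (- x / b)) _ _ uv.
transitivity (\int[mu]_(x in `[u, v]) (x `^ c * expR (- x / b))%:E)%E.
  by apply: eq_integral => x _; rewrite /gamma_kernel addrK.
rewrite parts.
- rewrite [X in (_ - X)%E](_ : _ = \int[mu]_(x in `[u, v])
      - ((b * c)%:E * (gamma_kernel b c x)%:E))%E; last first.
    by apply: eq_integral => x _; rewrite /gamma_kernel -EFinM -EFinN; congr EFin; ring.
  rewrite integral_ge0N; last first.
    by move=> x _; rewrite mule_ge0// lee_fin ?gamma_kernel_ge0// mulr_ge0// ltW.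
  rewrite ge0_integralZl//; last 3 first.
  + by apply/measurable_EFinP; apply: measurable_gamma_kernel.
  + by move=> x _; rewrite lee_fin gamma_kernel_ge0.
  + by rewrite lee_fin mulr_ge0// ltW.
  rewrite oppeK /gamma_kernel !addrK; congr (_%:E + _)%E.
  by ring.
- move=> x; apply: cvgM; [exact: cvg_cst|exact: powc].
- split; [move=> x xuv; have [] // := dF x|..].
  + by rewrite itv_gt0// subset_itv_oo_cc.
  + exact/cvg_at_right_filter/powcx.
  + exact/cvg_at_left_filter/powcx/(lt_trans u0).
- move=> x xuv; rewrite derive1E; apply: derive_val.
  exact/dF/itv_gt0/subset_itv_oo_cc.
- apply: continuous_subspaceT => x; apply/differentiable_continuous/derivable1_diffP.
  have -> : (fun x => expR (- x / b)) = (- b^-1) \*: (fun x => - b * expR (- x / b)).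
    by apply/funext => z /=; rewrite /GRing.scale/= mulrA mulrNN mulVf ?gt_eqF// mul1r.
  by apply: derivableZ; have [] := dG x.
- split.
  + by move=> x _; have [] := dG x.
  + exact/cvg_at_right_filter/contG.
  + exact/cvg_at_left_filter/contG.
- by move=> x xuv; rewrite derive1E; apply: derive_val.
Qed.

(** The recurrence Gamma(c + 1) = c Gamma(c).  The identity on compact
    intervals passes to the limit by monotone convergence, because the boundary
    terms vanish at 0 and at infinity.  Stated in the extended reals, it
    transfers finiteness from one integral to the other. *)
Lemma integral_gamma_kernelS b c : 0 < b -> 0 < c ->
  (\int[mu]_(x in `]0%R, +oo[) (gamma_kernel b (c + 1) x)%:E =
   (b * c)%:E * \int[mu]_(x in `]0%R, +oo[) (gamma_kernel b c x)%:E)%E.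
Proof.
move=> b0 c0; pose F n : set R := `[n.+2%:R^-1, n.+2%:R]%classic.
have UF : `]0%R, +oo[%classic = \bigcup_n F n.
  apply/seteqP; split => [x|x [n _]]; rewrite /F /= !in_itv/= ?andbT; last first.
    by move=> /andP[+ _]; apply: lt_le_trans; rewrite invr_gt0.
  move=> x0; pose n := (Num.truncn x + Num.truncn x^-1)%N.
  (* Both x and its inverse are less than n + 2. *)
  exists n => //=; rewrite in_itv/=; apply/andP; split.
    rewrite invf_ple ?posrE//; apply: (le_trans (ltW (truncnS_gt _))).
    by rewrite ler_nat ltnS leqW// leq_addl.
  apply: (le_trans (ltW (truncnS_gt _))).
  by rewrite ler_nat ltnS leqW// leq_addr.
have cvgF r : (\int[mu]_(x in F n) (gamma_kernel b r x)%:E)%E @[n --> \oo] -->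
    (\int[mu]_(x in `]0%R, +oo[) (gamma_kernel b r x)%:E)%E.
  rewrite UF; apply: ge0_nondecreasing_set_cvg_integral.
  - move=> n m nm; rewrite /F; apply/subsetPset/subset_itv; rewrite bnd_simp.
      by rewrite lef_pV2 ?posrE// ler_nat; lia.
    by rewrite ler_nat; lia.
  - by move=> n; exact: measurable_itv.
  - move=> n; apply/measurable_EFinP; apply: measurable_gamma_kernel.
    exact: measurable_itv.
  - by move=> n x _; rewrite lee_fin gamma_kernel_ge0.
apply: (cvg_unique _ (cvgF _)) => //=.
have -> : (fun n => (\int[mu]_(x in F n) (gamma_kernel b (c + 1) x)%:E)%E) =
    (fun n => (b * (gamma_kernel b (c + 1) n.+2%:R^-1 -
                    gamma_kernel b (c + 1) n.+2%:R))%:E +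
      (b * c)%:E * \int[mu]_(x in F n) (gamma_kernel b c x)%:E)%E.
  apply/funext => n; rewrite gamma_kernel_by_parts//.
  by rewrite (@lt_trans _ _ 1)// ?invf_lt1// ltr1n.
rewrite -[X in _ --> X]add0e; apply: cvgeD; first exact: fin_num_adde_defr.
  apply: cvg_EFin; first by near=> n.
  rewrite -(mulr0 b) -[in X in _ --> X](subr0 0); apply: cvgMr; apply: cvgB.
    exact: gamma_kernel_cvg0.
  exact: gamma_kernel_cvgy.
exact: cvgeZl.
Unshelve. all: by end_near. Qed.

End GammaIntegrals.

(** * Integrals with respect to densities and products of independent variables *)

Section IntegralFormulas.
Local Open Scope ereal_scope.

(** A function that represents [nu] is almost everywhere equal to the
    Radon-Nikodym derivative, for which the change of variables is known. *)
Lemma ge0_integral_density d (T : measurableType d) (R : realType)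
    (nu : {finite_measure set T -> \bar R})
    (mu : {sigma_finite_measure set T -> \bar R}) (f g : T -> \bar R) :
  (forall x, 0 <= f x) -> measurable_fun setT f ->
  (forall A, measurable A -> nu A = \int[mu]_(x in A) f x) ->
  (forall x, 0 <= g x) -> measurable_fun setT g ->
  \int[nu]_x g x = \int[mu]_x (g x * f x).
Proof.
move=> f0 mf nuE g0 mg.
have numu : nu `<< mu.
  apply/null_content_dominatesP => A mA muA0.
  by rewrite nuE// null_set_integral//; exact: measurable_funTS.
rewrite -(Radon_Nikodym_SigmaFinite.change_of_variables numu)//.
have mh := measurable_int _ (Radon_Nikodym_SigmaFinite.f_integrable numu).
apply: ae_eq_integral => //; [exact: emeasurable_funM..|].
apply: ae_eqe_mul2l; apply: integral_ae_eq => //.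
  exact: Radon_Nikodym_SigmaFinite.f_integrable.
by move=> E _ mE; rewrite -nuE// -Radon_Nikodym_SigmaFinite.f_integral.
Qed.

(** Independence says that the joint law and the product of the laws agree
    on rectangles, hence everywhere, and Tonelli's theorem applies. *)
Lemma ge0_integral_independentM d (T : measurableType d) (R : realType)
    (P : probability T R) (X Y : {RV P >-> R}) (f g : R -> \bar R) :
  (forall A B, measurable A -> measurable B ->
    P (X @^-1` A `&` Y @^-1` B) = P (X @^-1` A) * P (Y @^-1` B)) ->
  measurable_fun setT f -> (forall x, 0 <= f x) ->
  measurable_fun setT g -> (forall x, 0 <= g x) ->
  \int[P]_w (f (X w) * g (Y w)) = (\int[P]_w f (X w)) * (\int[P]_w g (Y w)).
Proof.
move=> indep mf f0 mg g0.
have mXY : measurable_fun setT (fun w => (X w, Y w)) by exact: measurable_fun_pair.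
pose XY : {mfun T >-> (R * R)%type} :=
  HB.pack (fun w => (X w, Y w)) (isMeasurableFun.Build _ _ _ _ _ mXY).
have prodE A : measurable A ->
    (distribution P X \x distribution P Y) A = distribution P XY A.
  apply: product_measure_unique => {}A B mA mB.
  by rewrite /distribution/= /pushforward -indep.
pose h (z : R * R) := f z.1 * g z.2.
have mh : measurable_fun setT h.
  by apply: emeasurable_funM; exact: measurableT_comp.
have h0 z : 0 <= h z by rewrite mule_ge0.
transitivity (\int[distribution P XY]_z h z); first by rewrite ge0_integral_distribution.
transitivity (\int[distribution P X \x distribution P Y]_z h z).
  by apply: eq_measure_integral => A mA _; first [exact: prodE|exact/esym/prodE].
rewrite fubini_tonelli1// /fubini_F /h/=.
under eq_integral do rewrite ge0_integralZl//.
rewrite ge0_integralZr//; last by apply: integral_ge0.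
by rewrite !ge0_integral_distribution.
Qed.
End IntegralFormulas.

(** * Moments of the Gamma law *)

Section GammaLaw.
Context d (T : measurableType d) (R : realType) (P : probability T R).
Variables (a b : R) (X : {RV P >-> R}).
Hypotheses (a0 : 0 < a) (b0 : 0 < b) (lawX : has_gamma_law a b X).
Local Notation mu := (@lebesgue_measure R).

Let k := (Gamma_fun a * b `^ a)^-1.

Let k0 : 0 <= k.
Proof.
rewrite invr_ge0 mulr_ge0 ?powR_ge0// fine_ge0//; apply: integral_ge0 => x _.
by rewrite lee_fin mulr_ge0 ?powR_ge0 ?expR_ge0.
Qed.

Let gamma_pdfE : gamma_pdf a b = (fun x => k * gamma_kernel b a x) \_ `]0, +oo[.
Proof.
apply/funext => x; rewrite patchE mem_setE in_itv/= andbT /gamma_pdf.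
by case: ifP => // _; rewrite mulrC.
Qed.

Let gamma_pdf_ge0 x : 0 <= gamma_pdf a b x.
Proof.
rewrite gamma_pdfE patchE; case: ifP => // _.
by rewrite mulr_ge0// gamma_kernel_ge0.
Qed.

Let measurable_gamma_pdf : measurable_fun setT (gamma_pdf a b).
Proof.
rewrite gamma_pdfE; apply/(measurable_restrictT _ (measurable_itv _)).
by apply: measurable_funM => //; exact: measurable_gamma_kernel.
Qed.

(** The positive part makes the integrand nonnegative everywhere; it is
    almost surely invisible. *)
Lemma gamma_law_momentE (m : nat) :
  (\int[P]_w ((Num.max (X w) 0) ^+ m)%:E =
   k%:E * \int[mu]_(x in `]0%R, +oo[) (gamma_kernel b (a + m%:R) x)%:E)%E.
Proof.
pose g (x : R) := ((Num.max x 0) ^+ m)%:E.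
have mg : measurable_fun setT g.
  apply/measurable_EFinP; apply: measurable_funX.
  exact: measurable_maxr.
have g0 x : (0 <= g x)%E by rewrite lee_fin exprn_ge0// le_max lexx orbT.
(* The Lebesgue measure is defined on a copy of R that carries the same
   Borel sets under another display. *)
have mX : measurable_fun setT (X : T -> measurableTypeR R) by exact: measurable_funP X.
pose X' : {mfun T >-> measurableTypeR R} :=
  HB.pack (X : T -> measurableTypeR R) (isMeasurableFun.Build _ _ _ _ _ mX).
transitivity (\int[distribution P X']_x g x)%E.
  by rewrite ge0_integral_distribution.
transitivity (\int[mu]_x (g x * (gamma_pdf a b x)%:E))%E.
  apply: (@ge0_integral_density _ _ _ (distribution P X') mu
    (EFin \o gamma_pdf a b)) => //.
  exact/measurable_EFinP.
rewrite -ge0_integralZl//; last 2 first.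
- by apply/measurable_EFinP; exact: measurable_gamma_kernel.
- by move=> x _; rewrite lee_fin gamma_kernel_ge0.
rewrite [RHS]integral_mkcond/=; apply: eq_integral => x _.
rewrite /= gamma_pdfE !patchE mem_setE in_itv/= andbT.
case: ifPn => x0; last by rewrite mule0.
rewrite /g -!EFinM max_l ?ltW// /gamma_kernel; congr EFin.
rewrite addrAC (@powRD _ _ (a - 1)); last by rewrite (gt_eqF x0) implybT.
by rewrite powR_mulrn ?ltW//; ring.
Qed.

(** The case [m = 0] is the normalization: the value of the constant [k] never
    has to be computed. *)
Let moment0 : (k%:E * \int[mu]_(x in `]0%R, +oo[) (gamma_kernel b a x)%:E = 1)%E.
Proof.
have := gamma_law_momentE 0; rewrite addr0 => <-.
under eq_integral do rewrite expr0.
by rewrite integral_cst// mul1e; exact: probability_setT.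
Qed.

Let moment1 : (k%:E * \int[mu]_(x in `]0%R, +oo[) (gamma_kernel b (a + 1) x)%:E =
  (a * b)%:E)%E.
Proof.
by rewrite (integral_gamma_kernelS b0 a0) muleCA moment0 mule1 mulrC.
Qed.

Lemma gamma_law_mean : (\int[P]_w (Num.max (X w) 0)%:E = (a * b)%:E)%E.
Proof.
rewrite -moment1 -[in RHS](mulr1n 1) -gamma_law_momentE.
by apply: eq_integral => w _; rewrite expr1.
Qed.

Lemma gamma_law_sqr :
  (\int[P]_w ((Num.max (X w) 0) ^+ 2)%:E = (a * (a + 1) * b ^+ 2)%:E)%E.
Proof.
have a10 : 0 < a + 1 by rewrite addr_gt0.
rewrite gamma_law_momentE mulr2n addrA (integral_gamma_kernelS b0 a10) muleCA.
by rewrite moment1 -EFinM; congr EFin; ring.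
Qed.
End GammaLaw.

Lemma gamma_law_gt0 d (T : measurableType d) (R : realType)
    (P : probability T R) (a b : R) (X : {RV P >-> R}) :
  has_gamma_law a b X -> {ae P, forall w, 0 < X w}.
Proof.
move=> lawX; exists (X @^-1` `]-oo, 0]); split.
- by rewrite -[X in measurable X]setTI; exact: measurable_funP.
- have := lawX `]-oo, 0]%classic (measurable_itv _).
  rewrite /distribution /pushforward => ->; apply: integral0_eq => x.
  by rewrite /= in_itv/= => x0; rewrite /gamma_pdf ltNge x0.
- by move=> w /=; rewrite in_itv/= leNgt => /negP.
Qed.

(** * Moments of the Poisson law *)

Section PoissonMoments.
Context {R : realType}.
Implicit Types (r : R).
Local Open Scope ereal_scope.

Lemma poisson_pmf_sum1 r : (0 < r)%R -> \sum_(0 <= k <oo) (poisson_pmf r k)%:E = 1.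
Proof.
move=> r0; transitivity (poisson_prob r 0%N setT); last exact: probability_setT.
rewrite /poisson_prob r0 nneseries_esumT// => k.
by rewrite lee_fin poisson_pmf_ge0.
Qed.

(** From k pmf(r, k) = r pmf(r, k - 1); every factorial moment follows by
    iteration. *)
Lemma poisson_pmf_shift r (u : nat -> R) : (0 < r)%R -> (forall k, 0 <= u k)%R ->
  \sum_(0 <= k <oo) (k%:R * u k * poisson_pmf r k)%:E =
  r%:E * \sum_(0 <= k <oo) (u k.+1 * poisson_pmf r k)%:E.
Proof.
move=> r0 u0; rewrite -nneseriesZl; last first.
  by move=> k _; rewrite lee_fin mulr_ge0// poisson_pmf_ge0.
rewrite (nneseries_split 0 1); last first.
  by move=> k _; rewrite lee_fin !mulr_ge0// poisson_pmf_ge0.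
rewrite big_nat1 !mul0r add0e -(nneseries_addn 1); last first.
  by move=> k; rewrite lee_fin !mulr_ge0// poisson_pmf_ge0.
apply: eq_eseriesr => k _; rewrite addn1 -EFinM /poisson_pmf r0; congr EFin.
rewrite factS natrM exprS; field.
by rewrite addrC natr1 !pnatr_eq0 -!lt0n fact_gt0.
Qed.

Lemma poisson_pmf_mean r : (0 < r)%R ->
  \sum_(0 <= k <oo) (k%:R * poisson_pmf r k)%:E = r%:E.
Proof.
move=> r0; have := @poisson_pmf_shift r (cst 1%R) r0 (fun=> ler01).
under eq_eseriesr do rewrite mulr1.
move=> ->; under eq_eseriesr do rewrite mul1r.
by rewrite poisson_pmf_sum1// mule1.
Qed.

Lemma poisson_pmf_sqr r : (0 < r)%R ->
  \sum_(0 <= k <oo) (k%:R ^+ 2 * poisson_pmf r k)%:E = (r ^+ 2 + r)%:E.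
Proof.
move=> r0; under eq_eseriesr do rewrite expr2.
rewrite (@poisson_pmf_shift r (fun k => k%:R) r0)//.
under eq_eseriesr do rewrite -natr1 mulrDl mul1r EFinD.
rewrite nneseriesD; last 2 first.
- by move=> k _ _; rewrite lee_fin mulr_ge0// poisson_pmf_ge0.
- by move=> k _ _; rewrite lee_fin poisson_pmf_ge0.
rewrite poisson_pmf_mean// poisson_pmf_sum1// -EFinD -EFinM.
by congr EFin; ring.
Qed.

End PoissonMoments.

(** * Integrals of count variables *)

Section CountIntegral.
Local Open Scope ereal_scope.

Lemma measurable_count_preimage d (T : measurableType d) (R : realType)
    (P : probability T R) (y : {RV P >-> nat}) k :
  measurable (y @^-1` [set k]).
Proof. by rewrite -[X in measurable X]setTI; exact: measurable_funP. Qed.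

Lemma measurable_count d (T : measurableType d) (R : realType)
    (P : probability T R) (y : {RV P >-> nat}) (u : nat -> R) :
  measurable_fun setT (fun w => u (y w)).
Proof. by apply: (@measurableT_comp _ _ _ _ _ _ u). Qed.

(** The level sets of a count variable are a countable partition. *)
Lemma ge0_integral_count_partition d (T : measurableType d) (R : realType)
    (P : probability T R) (y : {RV P >-> nat}) (D : set T) (g : T -> \bar R) :
  measurable D -> measurable_fun D g -> (forall w, 0 <= g w) ->
  \int[P]_(w in D) g w =
  \sum_(0 <= k <oo) \int[P]_(w in D `&` y @^-1` [set k]) g w.
Proof.
move=> mD mg g0.
have UD : D = \bigcup_k (D `&` y @^-1` [set k]).
  rewrite -setI_bigcupr -preimage_bigcup; apply/seteqP; split => [w Dw|w []//].
  by split => //; exists (y w).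
have my k : measurable (D `&` y @^-1` [set k]).
  by apply: measurableI => //; exact: measurable_count_preimage.
rewrite {1}UD ge0_integral_bigcup//=; first by rewrite -UD.
apply/trivIsetP => i j _ _ ij; rewrite -subset0 => w /= [[_ ->] [_ /eqP]].
by rewrite (negbTE ij).
Qed.

Lemma ge0_integral_count d (T : measurableType d) (R : realType)
    (P : probability T R) (y : {RV P >-> nat}) (D : set T) (u : nat -> R) :
  measurable D -> (forall k, (0 <= u k)%R) ->
  \int[P]_(w in D) (u (y w))%:E =
  \sum_(0 <= k <oo) (u k)%:E * P (D `&` y @^-1` [set k]).
Proof.
move=> mD u0; rewrite (ge0_integral_count_partition y)//; last 2 first.
- by apply/measurable_EFinP/measurable_funTS; exact: measurable_count.
- by move=> w; rewrite lee_fin.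
apply: eq_eseriesr => k _; rewrite -integral_cst//; last first.
  by apply: measurableI => //; exact: measurable_count_preimage.
by apply: eq_integral => w; rewrite inE => -[_ ->].
Qed.

End CountIntegral.

(** * Moments of the measurements *)

Section Model.
Context d (T : measurableType d) (R : realType) (P : probability T R).
Variables (a b : R) (n : option nat -> nat).
Hypotheses (a0 : 0 < a) (b0 : 0 < b).
Variables (rate : option nat -> {RV P >-> R})
  (y : option nat -> nat -> {RV P >-> nat}).
Hypothesis model : gamma_poisson_model a b n rate y.
Local Open Scope ereal_scope.

Lemma rate_independent i j : i != j -> forall A B, measurable A -> measurable B ->
  P (rate i @^-1` A `&` rate j @^-1` B) = P (rate i @^-1` A) * P (rate j @^-1` B).
Proof.
move=> ij A B mA mB.
have uij : uniq [:: i; j] by rewrite /= inE ij.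
have mC k : measurable (if k == i then A else B) by case: ifP.
have := rate_indep model uij mC.
rewrite big_cons big_seq1 eqxx eq_sym (negbTE ij) => <-; congr (P _).
apply/seteqP; split => [w [/= Aw Bw] k|w /= H].
  by rewrite !inE => /orP[] /eqP ->; rewrite ?eqxx// eq_sym (negbTE ij).
have := H i; have := H j.
by rewrite !inE !eqxx orbT eq_sym (negbTE ij) => /(_ isT) ? /(_ isT) ?.
Qed.

(** Conditional probabilities integrate to probabilities, the whole space
    being in the conditioning sigma-algebra. *)
Lemma measurement_law_setT (F : seq (option nat * nat)) k : uniq F ->
  (forall p, p \in F -> (p.2 < n p.1)%N) ->
  P [set w | forall p, p \in F -> y p.1 p.2 w = k p] =
  \int[P]_w (\prod_(p <- F) poisson_pmf (rate p.1 w) (k p))%:E.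
Proof.
move=> uF nF; have [_ _] := measurement_law model k uF nF.
move=> /(_ setT); rewrite setTI => -> //.
have [s0 sC _] := smallest_sigma_algebra setT
  (\bigcup_(i in [set: option nat]) preimage_set_system setT (rate i) measurable).
by have := sC _ s0; rewrite setD0.
Qed.

Lemma measurement_pmf i l k : (l < n i)%N ->
  P (y i l @^-1` [set k]) = \int[P]_w (poisson_pmf (rate i w) k)%:E.
Proof.
move=> ln.
have := @measurement_law_setT [:: (i, l)] (fun=> k) isT.
under eq_integral do rewrite big_seq1.
move=> <-; last by move=> p; rewrite inE => /eqP ->.
congr (P _); apply/seteqP; split => [w /= yw p|w /= /(_ (i, l))]; last first.
  by rewrite inE eqxx => /(_ isT).
by rewrite inE => /eqP ->.
Qed.

(** Given the rates the pair law is a product; integrating and using the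
    independence of the two rates, it remains a product. *)
Lemma measurement_pair_pmf i l j m k h : i != j -> (l < n i)%N -> (m < n j)%N ->
  P (y i l @^-1` [set k] `&` y j m @^-1` [set h]) =
  P (y i l @^-1` [set k]) * P (y j m @^-1` [set h]).
Proof.
move=> ij ln mn.
have mpmf k' : measurable_fun setT (fun r : R => (poisson_pmf r k')%:E).
  by apply/measurable_EFinP; exact: measurable_poisson_pmf.
have pmf0 k' (r : R) : 0 <= (poisson_pmf r k')%:E by rewrite lee_fin poisson_pmf_ge0.
have := ge0_integral_independentM (rate_independent ij) (mpmf k) (pmf0 k)
  (mpmf h) (pmf0 h).
rewrite !measurement_pmf// => <-.
have uF : uniq [:: (i, l); (j, m)].
  by rewrite /= inE andbT xpair_eqE (negbTE ij).
have := @measurement_law_setT _ (fun p => if p.1 == i then k else h) uF.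
under eq_integral do rewrite big_cons big_seq1/= eqxx eq_sym (negbTE ij) EFinM.
move=> <-; last by move=> p; rewrite !inE => /orP[] /eqP ->.
congr (P _); apply/seteqP; split => [w [/= yk yh] p|w /= H].
  by rewrite !inE => /orP[] /eqP -> /=; rewrite ?eqxx// eq_sym (negbTE ij).
have := H (i, l); have := H (j, m).
by rewrite !inE !eqxx/= ?orbT ?eqxx [j == i]eq_sym (negbTE ij) => /(_ isT) ? /(_ isT) ?.
Qed.

(** Mixing Poisson moments over the rate.  The mass function at a nonpositive
    rate is not summable, hence the passage through almost everywhere equality. *)
Lemma measurement_moment i l (u : nat -> R) (v : R -> R) :
  (l < n i)%N -> (forall k, 0 <= u k)%R ->
  measurable_fun setT v ->
  (forall r, (0 < r)%R -> \sum_(0 <= k <oo) (u k * poisson_pmf r k)%:E = (v r)%:E) ->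
  \int[P]_w (u (y i l w))%:E = \int[P]_w (v (Num.max (rate i w) 0))%:E.
Proof.
move=> ln u0 mv uv; rewrite ge0_integral_count//.
have mpmf k : measurable_fun setT (fun w => (u k * poisson_pmf (rate i w) k)%:E).
  apply/measurable_EFinP; apply: measurable_funM => //.
  by apply: (measurableT_comp (measurable_poisson_pmf k _)).
have pmf0 k w : 0 <= (u k * poisson_pmf (rate i w) k)%:E.
  by rewrite lee_fin mulr_ge0// poisson_pmf_ge0.
transitivity (\int[P]_w \sum_(0 <= k <oo) (u k * poisson_pmf (rate i w) k)%:E).
  rewrite integral_nneseries//; apply: eq_eseriesr => k _.
  rewrite setTI measurement_pmf// -ge0_integralZl//.
  - by apply/measurable_EFinP; apply: (measurableT_comp (measurable_poisson_pmf k _)).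
  - by move=> w _; rewrite lee_fin poisson_pmf_ge0.
  - by rewrite lee_fin.
apply: ae_eq_integral => //.
- by apply: ge0_emeasurable_sum => // k; exact: mpmf.
- apply/measurable_EFinP; apply: measurableT_comp => //.
  exact: measurable_maxr.
apply: filterS (gamma_law_gt0 (rate_law model i)) => w rw _.
by rewrite uv// max_l// ltW.
Qed.

Lemma measurement_mean i l : (l < n i)%N ->
  \int[P]_w (y i l w)%:R%:E = (a * b)%:E.
Proof.
move=> ln; rewrite -(gamma_law_mean a0 b0 (rate_law model i)).
apply: (@measurement_moment _ _ (fun k => k%:R) id) => //.
exact: poisson_pmf_mean.
Qed.

Lemma measurement_sqr i l : (l < n i)%N ->
  \int[P]_w ((y i l w)%:R ^+ 2)%:E = (a * (a + 1) * b ^+ 2 + a * b)%:E.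
Proof.
move=> ln; rewrite EFinD -(gamma_law_sqr a0 b0 (rate_law model i)).
rewrite -(gamma_law_mean a0 b0 (rate_law model i)) -ge0_integralD//; last 4 first.
- by move=> w _; rewrite lee_fin exprn_ge0// le_max lexx orbT.
- by apply/measurable_EFinP; apply: measurable_funX; exact: measurable_maxr.
- by move=> w _; rewrite lee_fin le_max lexx orbT.
- by apply/measurable_EFinP; exact: measurable_maxr.
apply: (@measurement_moment _ _ (fun k => k%:R ^+ 2)%R (fun r => r ^+ 2 + r)%R) => //.
- by apply: measurable_funD => //; exact: measurable_funX.
- exact: poisson_pmf_sqr.
Qed.

(** Both sides are double sums over the values of the two measurements; the sum
    over the second value is done first. *)
Lemma measurement_pair_mean i l j m : i != j -> (l < n i)%N -> (m < n j)%N ->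
  \int[P]_w ((y i l w)%:R * (y j m w)%:R)%:E = (a * b)%:E * (a * b)%:E.
Proof.
move=> ij ln mn.
have mpre := @measurable_count_preimage _ _ _ P.
rewrite (ge0_integral_count_partition (y i l))//; last first.
  by apply/measurable_EFinP; apply: measurable_funM; exact: measurable_count.
transitivity (\sum_(0 <= k <oo) (k%:R%:E * P (y i l @^-1` [set k])) * (a * b)%:E).
  apply: eq_eseriesr => k _; rewrite setTI.
  transitivity (\int[P]_(w in y i l @^-1` [set k]) (k%:R%:E * (y j m w)%:R%:E)).
    by apply: eq_integral => w; rewrite inE => /= ->.
  rewrite ge0_integralZl//; last first.
    by apply/measurable_EFinP/measurable_funTS; exact: measurable_count.
  rewrite -muleA; congr (_ * _).
  rewrite (@ge0_integral_count _ _ _ _ _ _ (fun h => h%:R))//.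
  under eq_eseriesr do rewrite measurement_pair_pmf// muleCA.
  rewrite -(fineK (fin_num_measure P _ (mpre (y i l) k))).
  rewrite nneseriesZl; last by move=> h _; rewrite mule_ge0// lee_fin.
  congr (_ * _); rewrite -(measurement_mean mn).
  rewrite (@ge0_integral_count _ _ _ _ _ _ (fun h => h%:R))//.
  by under [RHS]eq_eseriesr do rewrite setTI.
under eq_eseriesr do rewrite muleC.
rewrite nneseriesZl; last by move=> k _; rewrite mule_ge0// lee_fin.
congr (_ * _); rewrite -(measurement_mean ln).
rewrite (@ge0_integral_count _ _ _ _ _ _ (fun h => h%:R))//.
by under [RHS]eq_eseriesr do rewrite setTI.
Qed.

End Model.

(** * Variances of sums of square-integrable variables *)

Section SquareIntegrable.
Context d (T : measurableType d) (R : realType) (P : probability T R).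
Local Open Scope ereal_scope.

(** The usual criterion for square integrability, in terms of the integral of
    the square instead of the norm. *)
Lemma Lfun2_sqr (f : T -> R) : measurable_fun setT f ->
  \int[P]_w (f w ^+ 2)%:E < +oo -> f \in Lfun P 2%:E.
Proof.
move=> mf f2; rewrite inE; apply/andP; split; rewrite inE//=.
rewrite /finite_norm unlock /Lnorm; apply: poweR_lty.
rewrite (le_lt_trans _ f2)//; apply: ge0_le_integral => //=.
- apply/measurable_EFinP; apply: (measurableT_comp (measurable_powR _)) => //.
  exact: measurableT_comp.
- by apply/measurable_EFinP; exact: measurable_funX.
- by move=> w _; rewrite lee_fin (powR_mulrn 2)// real_normK// num_real.
Qed.

Lemma Lfun2_Lfun1 (f : T -> R) : f \in Lfun P 2%:E -> f \in Lfun P 1.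
Proof. by apply: Lfun_subset12; exact: fin_num_measure. Qed.

Implicit Types X : nat -> T -> R.

Lemma Lfun2_sum X N : (forall i, (i < N)%N -> X i \in Lfun P 2%:E) ->
  (fun w => \sum_(i < N) X i w)%R \in Lfun P 2%:E.
Proof.
elim: N => [|N IH] X2.
  rewrite (_ : (fun w => _) = cst 0%R) ?Lfun_cst//.
  by apply/funext => w; rewrite big_ord0.
rewrite (_ : (fun w => _) = (fun w => \sum_(i < N) X i w) \+ X N)%R; last first.
  by apply/funext => w; rewrite big_ord_recr.
have XN := X2 N (ltnSn N); have SN := IH (fun i iN => X2 i (leqW iN)).
by rewrite rpredD ?lee1n.
Qed.

Lemma expectation_sum_ord X N : (forall i, (i < N)%N -> X i \in Lfun P 2%:E) ->
  'E_P[(fun w => \sum_(i < N) X i w)%R] = \sum_(i < N) 'E_P[X i].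
Proof.
elim: N => [|N IH] X2.
  rewrite big_ord0 (_ : (fun w => _) = cst 0%R) ?expectation_cst//.
  by apply/funext => w; rewrite big_ord0.
have X2' i : (i < N)%N -> X i \in Lfun P 2%:E by move=> iN; exact: X2 (leqW iN).
rewrite big_ord_recr/= -IH// -expectationD; last 2 first.
- exact/Lfun2_Lfun1/Lfun2_sum.
- exact/Lfun2_Lfun1/X2.
by congr expectation; apply/funext => w; rewrite big_ord_recr.
Qed.

Lemma covariance_suml0 X N (Z : T -> R) :
  (forall i, (i < N)%N -> X i \in Lfun P 2%:E) -> Z \in Lfun P 2%:E ->
  (forall i, (i < N)%N -> covariance P (X i) Z = 0) ->
  covariance P (fun w => \sum_(i < N) X i w)%R Z = 0.
Proof.
move=> + Z2; elim: N => [|N IH] X2 XZ0.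
  rewrite (_ : (fun w => _) = cst 0%R) ?covariance_cst_l//.
  by apply/funext => w; rewrite big_ord0.
have X2' i : (i < N)%N -> X i \in Lfun P 2%:E by move=> iN; exact: X2 (leqW iN).
rewrite (_ : (fun w => _) = (fun w => \sum_(i < N) X i w)%R \+ X N)%R; last first.
  by apply/funext => w; rewrite big_ord_recr.
rewrite covarianceDl//; [|exact: Lfun2_sum|exact: X2].
by rewrite XZ0// adde0 IH// => i iN; rewrite XZ0// ltnW.
Qed.

Lemma variance_sum_uncorrelated X N :
  (forall i, (i < N)%N -> X i \in Lfun P 2%:E) ->
  (forall i j, (i < N)%N -> (j < N)%N -> i != j -> covariance P (X i) (X j) = 0) ->
  variance P (fun w => \sum_(i < N) X i w)%R = \sum_(i < N) variance P (X i).
Proof.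
elim: N => [|N IH] X2 cov0.
  rewrite big_ord0 (_ : (fun w => _) = cst 0%R) ?variance_cst//.
  by apply/funext => w; rewrite big_ord0.
have X2' i : (i < N)%N -> X i \in Lfun P 2%:E by move=> iN; exact: X2 (leqW iN).
rewrite big_ord_recr/= -IH//; last first.
  by move=> i j iN jN; exact: cov0 (leqW iN) (leqW jN).
rewrite (_ : (fun w => _) = (fun w => \sum_(i < N) X i w)%R \+ X N)%R; last first.
  by apply/funext => w; rewrite big_ord_recr.
rewrite varianceD//; [|exact: Lfun2_sum|exact: X2].
rewrite covariance_suml0 ?mule0 ?adde0//; first exact: X2.
by move=> i iN; apply: (cov0 _ _ (leqW iN) (ltnSn N)); rewrite neq_ltn iN.
Qed.

(** The difference of the two sides is the variance of [X - Y]. *)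
Lemma variance_add_le (X Y : T -> R) : X \in Lfun P 2%:E -> Y \in Lfun P 2%:E ->
  variance P (X \+ Y)%R <= 2%:E * (variance P X + variance P Y).
Proof.
move=> X2 Y2; have := variance_ge0 P (X \- Y)%R.
rewrite varianceB// varianceD//.
have cfin : covariance P X Y \is a fin_num.
  by rewrite covariance_fin_num ?Lfun2_mul_Lfun1 ?Lfun2_Lfun1.
have := variance_fin_num X2; have := variance_fin_num Y2.
move/fineK => <- /fineK <-; rewrite -(fineK cfin).
rewrite !(=^~ EFinM, =^~ EFinN, =^~ EFinD) !lee_fin; lra.
Qed.

(** A crude bound, enough because an agent has boundedly many measurements. *)
Lemma variance_sum_le X N (v : R) : (0 <= v)%R ->
  (forall i, (i < N)%N -> X i \in Lfun P 2%:E) ->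
  (forall i, (i < N)%N -> variance P (X i) <= v%:E) ->
  variance P (fun w => \sum_(i < N) X i w)%R <= (4 ^+ N * v)%:E.
Proof.
move=> v0; elim: N => [|N IH] X2 Xv.
  rewrite (_ : (fun w => _) = cst 0%R) ?variance_cst ?lee_fin ?mulr_ge0//.
  by apply/funext => w; rewrite big_ord0.
have X2' i : (i < N)%N -> X i \in Lfun P 2%:E by move=> iN; exact: X2 (leqW iN).
rewrite (_ : (fun w => _) = (fun w => \sum_(i < N) X i w)%R \+ X N)%R; last first.
  by apply/funext => w; rewrite big_ord_recr.
apply: (le_trans (variance_add_le _ _)); [exact: Lfun2_sum|exact: X2|].
have hN : variance P (fun w => \sum_(i < N) X i w)%R <= (4 ^+ N * v)%:E.
  by apply: IH => // i iN; rewrite Xv// ltnW.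
apply: (@le_trans _ _ (2%:E * ((4 ^+ N * v)%:E + v%:E))).
  by rewrite lee_pmul2l// leeD// Xv.
rewrite -EFinD -EFinM lee_fin exprS.
have : (1 <= 4 ^+ N :> R)%R by rewrite exprn_ege1// ler1n.
by nra.
Qed.

End SquareIntegrable.

(** * Fluctuations of the total counts *)

Section Counts.
Context d (T : measurableType d) (R : realType) (P : probability T R).
Variables (a b : R) (nmax : nat) (n : option nat -> nat).
Hypotheses (a0 : 0 < a) (b0 : 0 < b).
Hypothesis hn : forall i, (1 <= n i <= nmax)%N.
Variables (rate : option nat -> {RV P >-> R})
  (y : option nat -> nat -> {RV P >-> nat}).
Hypothesis model : gamma_poisson_model a b n rate y.
Local Open Scope ereal_scope.

Definition total_countR (i : option nat) (w : T) : R :=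
  (total_count n (fun i l => y i l : T -> nat) i w)%:R.

Lemma total_countRE i : total_countR i = (fun w => \sum_(l < n i) (y i l w)%:R)%R.
Proof. by apply/funext => w; rewrite /total_countR /total_count natr_sum. Qed.

Let v0 : R := a * (a + 1) * b ^+ 2 + a * b.

Let v0_ge0 : (0 <= v0)%R.
Proof. by rewrite /v0 addr_ge0 ?mulr_ge0 ?addr_ge0 ?exprn_ge0 ?ltW. Qed.

Lemma measurement_Lfun2 i l : (l < n i)%N ->
  (fun w => (y i l w)%:R : R) \in Lfun P 2%:E.
Proof.
move=> ln; apply: Lfun2_sqr; first exact: measurable_count.
by rewrite (measurement_sqr a0 b0 model ln) ltry.
Qed.

Lemma measurement_expectation i l : (l < n i)%N ->
  'E_P[(fun w => (y i l w)%:R : R)] = (a * b)%:E.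
Proof. by move=> ln; rewrite unlock (measurement_mean a0 b0 model ln). Qed.

Lemma measurement_uncorrelated i l j m : i != j -> (l < n i)%N -> (m < n j)%N ->
  covariance P (fun w => (y i l w)%:R : R)%R (fun w => (y j m w)%:R : R)%R = 0.
Proof.
move=> ij ln mn; have Xl := measurement_Lfun2 ln; have Xm := measurement_Lfun2 mn.
have Xlm := Lfun2_mul_Lfun1 Xl Xm.
rewrite covarianceE//; [|exact: Lfun2_Lfun1|exact: Lfun2_Lfun1].
rewrite !measurement_expectation// unlock.
by rewrite (measurement_pair_mean a0 b0 model ij ln mn) subee.
Qed.

Lemma measurement_variance_le i l : (l < n i)%N ->
  variance P (fun w => (y i l w)%:R : R) <= v0%:E.
Proof.
move=> ln; rewrite varianceE ?measurement_Lfun2// measurement_expectation//.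
rewrite leeBlDr// unlock.
have -> : \int[P]_w (((fun w => (y i l w)%:R : R) ^+ 2)%R w)%:E = v0%:E.
  by rewrite -(measurement_sqr a0 b0 model ln); apply: eq_integral.
by rewrite leeDl// -EFin_expe lee_fin sqr_ge0.
Qed.

Lemma total_count_Lfun2 i : total_countR i \in Lfun P 2%:E.
Proof.
rewrite total_countRE; apply: (@Lfun2_sum _ _ _ _ (fun l w => (y i l w)%:R)) => l ln.
exact: measurement_Lfun2.
Qed.

Lemma total_count_expectation i : 'E_P[total_countR i] = ((n i)%:R * (a * b))%:E.
Proof.
rewrite total_countRE.
rewrite (@expectation_sum_ord _ _ _ _ (fun l w => (y i l w)%:R))//; last first.
  exact: measurement_Lfun2.
rewrite (eq_bigr (fun=> (a * b)%:E)) => [|l _]; last exact: measurement_expectation.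
by rewrite sumEFin sumr_const card_ord mulr_natl.
Qed.

Lemma total_count_uncorrelated i j : i != j ->
  covariance P (total_countR i) (total_countR j) = 0.
Proof.
move=> ij; rewrite [total_countR i]total_countRE.
apply: (@covariance_suml0 _ _ _ _ (fun l w => (y i l w)%:R)) => [l ln||l ln].
- exact: measurement_Lfun2.
- exact: total_count_Lfun2.
rewrite covarianceC total_countRE.
apply: (@covariance_suml0 _ _ _ _ (fun l w => (y j l w)%:R)) => [m mn||m mn].
- exact: measurement_Lfun2.
- exact: measurement_Lfun2.
by apply: measurement_uncorrelated => //; rewrite eq_sym.
Qed.

Lemma total_count_variance_le i : variance P (total_countR i) <= (4 ^+ nmax * v0)%:E.
Proof.
rewrite total_countRE; apply: (@le_trans _ _ (4 ^+ n i * v0)%:E).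
  apply: (@variance_sum_le _ _ _ _ (fun l w => (y i l w)%:R)) => // l ln.
  - exact: measurement_Lfun2.
  - exact: measurement_variance_le.
rewrite lee_fin ler_wpM2r// ler_weXn2l ?ler1n//.
by have /andP[] := hn i.
Qed.

(** The left-hand side is the variance of a sum of uncorrelated variables, each
    of variance at most that of the count. *)
Lemma weighted_deviation_sqr N (c : nat -> R) : (forall i, `|c i| <= 1)%R ->
  \int[P]_w ((\sum_(i < N) c i *
    (total_countR (Some (i : nat)) w - (n (Some (i : nat)))%:R * (a * b))) ^+ 2)%:E
  <= (N%:R * (4 ^+ nmax * v0))%:E.
Proof.
move=> c1; pose X (i : nat) : T -> R := (c i \o* total_countR (Some i))%R.
have X2 i : X i \in Lfun P 2%:E.
  by rewrite Lfun_scale ?ler1n// total_count_Lfun2.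
have EX i : 'E_P[X i] = (c i * ((n (Some i))%:R * (a * b)))%:E.
  by rewrite /X expectationZl ?Lfun2_Lfun1 ?total_count_Lfun2// total_count_expectation.
have -> : \int[P]_w ((\sum_(i < N) c i *
    (total_countR (Some (i : nat)) w - (n (Some (i : nat)))%:R * (a * b))) ^+ 2)%:E =
    variance P (fun w => \sum_(i < N) X i w)%R.
  rewrite /variance covariance.unlock expectation_sum_ord//.
  under [in RHS]eq_bigr do rewrite EX.
  rewrite sumEFin expectation.unlock; apply: eq_integral => w _; congr EFin.
  rewrite -[RHS]/((\sum_(i < N) X i w -
    \sum_(i < N) c i * ((n (Some (i : nat)))%:R * (a * b))) ^+ 2)%R.
  rewrite -sumrB; congr (_ ^+ 2)%R; apply: eq_bigr => i _.
  by rewrite mulrBr /X/= mulrC.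
rewrite variance_sum_uncorrelated//; last first.
  move=> i j _ _ ij; have ijS : Some i != Some j by [].
  have Yi := total_count_Lfun2 (Some i); have Yj := total_count_Lfun2 (Some j).
  rewrite {1}/X covarianceZl; last 3 first.
  - exact: Lfun2_Lfun1.
  - exact: Lfun2_Lfun1 (X2 j).
  - exact: Lfun2_mul_Lfun1 Yi (X2 j).
  rewrite /X covarianceZr; last 3 first.
  - exact: Lfun2_Lfun1.
  - exact: Lfun2_Lfun1.
  - exact: Lfun2_mul_Lfun1 Yi Yj.
  by rewrite total_count_uncorrelated// !mule0.
have -> : (N%:R * (4 ^+ nmax * v0))%:E = \sum_(i < N) (4 ^+ nmax * v0)%:E.
  by rewrite sumEFin sumr_const card_ord mulr_natl.
apply: lee_sum => i _; rewrite /X varianceZ ?total_count_Lfun2//.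
apply: (le_trans _ (total_count_variance_le (Some (i : nat)))).
rewrite -[leRHS]mul1e lee_wpmul2r ?variance_ge0// lee_fin.
by rewrite -real_normK ?num_real// expr_le1.
Qed.

End Counts.

(** * Roots of the score *)

Section Score.
Context {R : realFieldType}.
Variables (a : R) (s m : nat -> R) (N : nat).
Hypotheses (a0 : 0 < a) (s0 : forall i, 0 <= s i).

(** This is [- t] times the derivative at [t] of the objective with counts [s]
    and sample sizes [m]. *)
Definition score (t : R) : R :=
  \sum_(i < N) (s i - a * m i * t) / (m i * t + 1).

Section Bounds.
Variable mmax : R.
Hypothesis m1 : forall i, 1 <= m i <= mmax.

Let m_ge1 i : 1 <= m i. Proof. by have /andP[] := m1 i. Qed.
Let m_le i : m i <= mmax. Proof. by have /andP[] := m1 i. Qed.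
Let m_gt0 i : 0 < m i. Proof. exact: lt_le_trans (m_ge1 i). Qed.
Let mmax_gt0 : 0 < mmax. Proof. exact: lt_le_trans (m_gt0 0%N) (m_le 0%N). Qed.

Let den_gt0 i t : 0 <= t -> 0 < m i * t + 1.
Proof. by move=> t0; rewrite ltr_wpDl// mulr_ge0// ltW. Qed.

(** The difference quotient of the score, up to sign. *)
Definition score_slope (u v : R) : R :=
  \sum_(i < N) (s i + a) * m i / ((m i * u + 1) * (m i * v + 1)).

Lemma score_sub u v : 0 <= u -> 0 <= v ->
  score u - score v = (v - u) * score_slope u v.
Proof.
move=> u0 v0; rewrite -sumrB mulr_sumr; apply: eq_bigr => i _.
by field; rewrite !gt_eqF ?den_gt0.
Qed.

Lemma score_slope_ge u v : 0 <= u -> 0 <= v ->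
  N%:R * (a / ((mmax * u + 1) * (mmax * v + 1))) <= score_slope u v.
Proof.
move=> u0 v0; rewrite -[N in N%:R]card_ord mulr_natl -sumr_const.
apply: ler_sum => i _; apply: ler_pM.
- exact: ltW.
- by rewrite invr_ge0 mulr_ge0// ltW// ltr_wpDl// mulr_ge0// ltW.
- apply: (@le_trans _ _ (s i + a)); first by rewrite lerDr.
  by rewrite ler_peMr// addr_ge0// ltW.
- rewrite lef_pV2 ?posrE ?mulr_gt0 ?den_gt0//; last first.
    by rewrite ltr_wpDl// mulr_ge0// ltW.
    by rewrite ltr_wpDl// mulr_ge0// ltW.
  by apply: ler_pM; rewrite ?(ltW (den_gt0 _ _))// lerD2r ler_wpM2r.
Qed.

(** The score is positive before its root and nonpositive from there on; this
    describes the sets on which the estimator exceeds a level, and hence gives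
    its measurability. *)
Lemma score_root_lt x t : (0 < N)%N -> 0 <= x -> score x = 0 -> 0 <= t ->
  (t < x) = (0 < score t).
Proof.
move=> N0 x0 sx t0; have -> : score t = (x - t) * score_slope t x.
  by rewrite -score_sub// sx subr0.
rewrite pmulr_lgt0 ?subr_gt0//; apply: lt_le_trans (score_slope_ge t0 x0).
rewrite mulr_gt0 ?ltr0n// divr_gt0// mulr_gt0// ltr_wpDl// mulr_ge0//; exact: ltW.
Qed.

(** Multiplied by [x + 1], the equation of the score becomes
    sum_i rho_i (s_i / m_i - a x) = 0 with all weights rho_i between 1 and the
    largest sample size, uniformly in [x]. *)
Lemma score_root_le_average x : 0 <= x -> score x = 0 ->
  a * x * N%:R <= mmax * \sum_(i < N) (m i)^-1 * s i.
Proof.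
move=> x0 sx; pose rho i := m i * (x + 1) / (m i * x + 1).
have rho_ge1 i : 1 <= rho i.
  by rewrite ler_pdivlMr ?den_gt0// mul1r mulrDr mulr1 lerD2l.
have rho_le i : rho i <= mmax.
  rewrite ler_pdivrMr ?den_gt0// mulrDr mulr1.
  apply: (@le_trans _ _ (m i * (m i * x + 1))).
    by rewrite mulrDr mulr1 lerD2r (ler_wpM2l (ltW (m_gt0 i)))// ler_peMl.
  by rewrite (ler_wpM2r (ltW (den_gt0 i x0))).
have : \sum_(i < N) rho i * ((m i)^-1 * s i - a * x) = 0.
  transitivity ((x + 1) * score x); last by rewrite sx mulr0.
  rewrite mulr_sumr; apply: eq_bigr => i _.
  by rewrite /rho; field; rewrite !gt_eqF ?den_gt0.
under eq_bigr do rewrite mulrBr.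
rewrite sumrB => /eqP; rewrite subr_eq0 => /eqP eq_rho.
rewrite mulr_sumr; apply: (@le_trans _ _ (\sum_(i < N) rho i * (a * x))).
  rewrite -[N in N%:R]card_ord mulr_natr -sumr_const; apply: ler_sum => i _.
  by rewrite ler_peMl// mulr_ge0// ltW.
rewrite -eq_rho; apply: ler_sum => i _.
by rewrite ler_wpM2r// mulr_ge0// invr_ge0 ltW.
Qed.

Section Deviation.
Variable b : R.
Hypothesis b0 : 0 < b.
Let M1 := \sum_(i < N) (m i * b + 1)^-1 * (s i - m i * (a * b)).
Let M2 := \sum_(i < N) (m i)^-1 * (s i - m i * (a * b)).
(** [C1^-1] bounds from below the slope per agent between [b] and any point of
    the interval from 0 to [2 * mmax * b]. *)
Let C1 := (mmax * b + 1) * (mmax * (2 * mmax * b) + 1) / a.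
Let C2 := 2 * mmax / a.

Let C1_gt0 : 0 < C1.
Proof. by rewrite divr_gt0// mulr_gt0// ltr_wpDl// !mulr_ge0// ltW. Qed.

(** Up to [2 * mmax * b] the slope of the score is bounded below and [M1], the
    score at [b], controls [x - b].  Beyond, the bound by averages leaves at
    least half of [x] to be accounted for by [M2]. *)
Lemma score_root_deviation x : (0 < N)%N -> 0 <= x -> score x = 0 ->
  (x - b) ^+ 2 * N%:R ^+ 2 <= C1 ^+ 2 * M1 ^+ 2 + C2 ^+ 2 * M2 ^+ 2.
Proof.
move=> N0 x0 sx; have N0' : 0 < N%:R :> R by rewrite ltr0n.
have [xb|bx] := leP x (2 * mmax * b).
  have sb : score b = M1 by apply: eq_bigr => i _; rewrite mulrC; congr (_ * _); ring.
  have slope : N%:R <= C1 * score_slope b x.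
    rewrite -ler_pdivrMl//; apply: le_trans (score_slope_ge (ltW b0) x0).
    rewrite mulrC ler_wpM2l// /C1 invf_div (ler_wpM2l (ltW a0))//.
    rewrite lef_pV2 ?posrE; last 2 first.
    - by rewrite mulr_gt0// ltr_wpDl// ?mulr_ge0// ltW.
    - by rewrite mulr_gt0// ltr_wpDl// ?mulr_ge0// ltW.
    rewrite ler_wpM2l//; first by rewrite ltW// ltr_wpDl// mulr_ge0// ltW.
    by rewrite lerD2r (ler_wpM2l (ltW mmax_gt0)).
  apply: (@le_trans _ _ (C1 ^+ 2 * M1 ^+ 2)); last first.
    by rewrite lerDl mulr_ge0// sqr_ge0.
  have -> : M1 = (x - b) * score_slope b x.
    by rewrite -(score_sub (ltW b0) x0) sx subr0 sb.
  rewrite -!exprMn.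
  rewrite -real_normK ?num_real// -[leRHS]real_normK ?num_real//.
  rewrite ler_pXn2r ?nnegrE// (normrM C1) !(normrM (x - b)).
  rewrite (gtr0_norm C1_gt0) (gtr0_norm N0') mulrCA ler_wpM2l//; apply: (le_trans slope).
  by rewrite (ler_wpM2l (ltW C1_gt0))// ler_norm.
have avg : a * x * N%:R <= mmax * (M2 + N%:R * (a * b)).
  have -> : M2 + N%:R * (a * b) = \sum_(i < N) (m i)^-1 * s i.
    rewrite -[N in N%:R]card_ord mulr_natl -sumr_const -big_split/=.
    by apply: eq_bigr => i _; rewrite mulrBr mulKf ?gt_eqF// subrK.
  exact: score_root_le_average.
have mmax_ge1 : 1 <= mmax by apply: le_trans (m_ge1 0%N) (m_le 0%N).
have xM2 : x * N%:R <= C2 * M2.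
  rewrite /C2 mulrAC ler_pdivlMr//.
  have : 2 * mmax * b * (a * N%:R) <= x * (a * N%:R)
    by rewrite ler_wpM2r ?(ltW bx)// mulr_ge0// ltW.
  lra.
apply: (@le_trans _ _ (C2 ^+ 2 * M2 ^+ 2)); last first.
  by rewrite lerDr mulr_ge0// sqr_ge0.
rewrite -!exprMn ler_pXn2r ?nnegrE//.
- by apply: le_trans xM2; rewrite (ler_wpM2r (ltW N0'))// lerBlDr lerDl ltW.
- rewrite mulr_ge0 ?ltW// subr_gt0; apply: le_lt_trans bx.
  rewrite -[leLHS]mul1r (ler_wpM2r (ltW b0))//; lra.
- by apply: le_trans xM2; rewrite mulr_ge0// ltW.
Qed.
End Deviation.
End Bounds.
End Score.

(** * The maximum likelihood estimate as a root of the score *)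

Section MLScore.
Context {R : realType}.
Variables (a : R) (N : nat) (n s : option nat -> nat) (x : R).
Hypothesis a0 : 0 < a.
Hypothesis xml : is_ml_estimate a N n s x.

Let sR i : R := (s (Some i))%:R.
Let nR i : R := (n (Some i))%:R.
Let S : R := \sum_(i < N) sR i.

(** The objective after cancellation of [a * N * ln t], which separates its
    singular part at 0 from a nonnegative one. *)
Definition ml_objective_split (t : R) : R :=
  - S * ln t + \sum_(i < N) (sR i + a) * ln (nR i * t + 1).

Let den_gt0 i t : 0 <= t -> 0 < nR i * t + 1.
Proof. by move=> t0; rewrite ltr_wpDl// mulr_ge0. Qed.

Lemma ml_objectiveE t : 0 < t -> ml_objective a N n s t = ml_objective_split t.
Proof.
move=> t0; rewrite /ml_objective /ml_objective_split.
transitivity (a * N%:R * ln t -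
  \sum_(i < N) ((sR i + a) * ln t - (sR i + a) * ln (nR i * t + 1))).
  congr (_ - _); apply: eq_bigr => i _.
  by rewrite ln_div ?posrE ?den_gt0 ?(ltW t0)// mulrBr.
rewrite sumrB -mulr_suml big_split/= sumr_const card_ord -mulr_natr -/S; ring.
Qed.

(** The singular part tends to infinity as soon as one count is nonzero. *)
Lemma ml_objective_cvgy : 0 < S ->
  (ml_objective a N n s t)%:E @[t --> (0 : R)^'+] --> +oo%E.
Proof.
move=> S0; apply/cvgeyPge => A; near=> t.
have t0 : 0 < t by near: t; exact: nbhs_right_gt.
have tA : t <= expR (- A / S).
  by near: t; apply: nbhs_right_le; exact: expR_gt0.
rewrite lee_fin ml_objectiveE// /ml_objective_split.
apply: (@le_trans _ _ (- S * ln t)).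
  have : ln t <= - A / S by rewrite -[leRHS]expRK ler_ln ?posrE ?expR_gt0.
  by rewrite ler_pdivlMr// => h; lra.
rewrite lerDl; apply: sumr_ge0 => i _; rewrite mulr_ge0 ?addr_ge0 ?(ltW a0)//.
by rewrite ln_ge0// lerDr mulr_ge0// ltW.
Unshelve. all: by end_near. Qed.

Lemma ml_estimate_ge0 : 0 <= x.
Proof. by have [] := xml. Qed.

(** Otherwise the objective would be infinite at 0 and finite at 1. *)
Lemma ml_estimate_eq0 : x = 0 -> S = 0.
Proof.
move=> x0; apply/eqP; rewrite eq_le sumr_ge0// andbT leNgt; apply/negP => S0.
have [_ /(_ 1 ler01) + _] := xml.
rewrite /ml_objective_ext x0 eqxx oner_eq0 (cvg_lim _ (ml_objective_cvgy S0))//.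
Qed.

Lemma is_derive_ml_objective (t : R) : 0 < t ->
  is_derive t 1 ml_objective_split
    (- S * t^-1 + \sum_(i < N) (sR i + a) * (nR i * t + 1)^-1 * nR i).
Proof.
move=> t0.
have h i : is_derive t 1 (fun t : R => (sR i + a) * ln (nR i * t + 1))
   ((sR i + a) * (nR i * t + 1)^-1 * nR i).
  rewrite -mulrA; apply: is_deriveZ.
  apply: (@is_derive1_comp _ (@ln R) (fun t : R => nR i * t + 1)).
    by apply: is_derive1_ln; rewrite den_gt0// ltW.
  rewrite -[X in is_derive _ _ _ X]addr0.
  apply: is_deriveD; rewrite -[X in is_derive _ _ _ X]mulr1.
  exact: (@is_deriveZ _ _ _ _ (nR i) _ _ _ (is_derive_id _ _)).
apply: is_deriveD.
  by apply: is_deriveZ; exact: is_derive1_ln.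
rewrite (_ : (fun _ => _) =
  \sum_(i < N) (fun t : R => (sR i + a) * ln (nR i * t + 1))).
  exact: is_derive_sum.
by apply/funext => u; rewrite fct_sumE.
Qed.

(** At a positive minimizer the derivative vanishes; at 0 the score is the sum
    of the counts, which vanishes. *)
Lemma ml_estimate_score : score a sR nR N x = 0.
Proof.
have := ml_estimate_ge0; rewrite le_eqVlt => /predU1P[x0|x0].
  rewrite -(ml_estimate_eq0 (esym x0)) -x0; apply: eq_bigr => i _.
  by rewrite !mulr0 subr0 add0r divr1.
have der0 : is_derive x 1 ml_objective_split 0.
  apply: (@derive1_at_min _ _ 0 (x + 1)).
  - by rewrite addr_ge0 ?ltW.
  - move=> t; rewrite in_itv/= => /andP[t0 _].
    by have [] := is_derive_ml_objective t0.
  - by rewrite in_itv/= x0 ltrDl ltr01.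
  - move=> t; rewrite in_itv/= => /andP[t0 _].
    have [_ /(_ t (ltW t0)) + _] := xml.
    by rewrite /ml_objective_ext !gt_eqF// lee_fin !ml_objectiveE.
have := is_derive_ml_objective x0.
move=> h; have := @derive_val _ _ _ _ _ _ _ h; rewrite (@derive_val _ _ _ _ _ _ _ der0).
move=> /(congr1 (fun z => - x * z)); rewrite mulr0 mulrDr mulrA mulrNN.
rewrite mulrAC mulfV ?gt_eqF// mul1r mulr_sumr -big_split/= => ->.
apply: eq_bigr => i _.
by field; rewrite gt_eqF ?den_gt0// ltW.
Qed.

End MLScore.

(** * Mean-square convergence *)

Section BiasVariance.
Context d (T : measurableType d) (R : realType) (P : probability T R).
Implicit Types (X : T -> R) (b : R).

Lemma var_ge0 X : 0 <= var P X.
Proof. by rewrite /var fine_ge0// variance_ge0. Qed.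

(** Applied with [b] the limit, one integral controls both the variance and the
    bias of the estimator. *)
Lemma bias_variance X b : X \in Lfun P 2%:E ->
  (\int[P]_w ((X w - b) ^+ 2)%:E = (var P X + (mean P X - b) ^+ 2)%:E)%E.
Proof.
move=> X2; have X1 := Lfun2_Lfun1 X2.
have Xb2 : X \- cst b \in Lfun P 2%:E.
  have b2 : cst b \in Lfun P 2%:E by exact: Lfun_cst.
  by rewrite rpredB ?lee1n.
have Xbfin := expectation_fin_num (Lfun2_Lfun1 Xb2).
have EXb : ('E_P[X \- cst b] = (mean P X - b)%:E)%E.
  rewrite expectationB ?Lfun_cst// expectation_cst EFinB /mean fineK//.
  exact: expectation_fin_num.
have := varianceE Xb2; rewrite varianceB_cst_r// EXb.
move=> VX; rewrite EFinD /var fineK; last exact: variance_fin_num.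
rewrite VX EFin_expe subeK; last by rewrite -EFin_expe.
by rewrite expectation.unlock; apply: eq_integral.
Qed.

End BiasVariance.

Section MeanSquareConvergence.
Context d (T : measurableType d) (R : realType) (P : probability T R).
Variables (X : nat -> T -> R) (b K : R).
Hypothesis X2 : forall N, X N \in Lfun P 2%:E.
Hypothesis XK : forall N, (0 < N)%N ->
  (\int[P]_w ((X N w - b) ^+ 2)%:E <= (K / N%:R)%:E)%E.

Let bound N : (0 < N)%N -> var P (X N) + (mean P (X N) - b) ^+ 2 <= K / N%:R.
Proof. by move=> N0; rewrite -lee_fin -bias_variance// XK. Qed.

Let cvgK : (fun N => K / N%:R) @ \oo --> (0 : R).
Proof.
rewrite -(mulr0 K); apply: cvgMr; rewrite -(cvg_shiftS).
exact: cvg_harmonic.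
Qed.

Lemma mean_square_cvg_var : var P (X N) @[N --> \oo] --> (0 : R).
Proof.
apply: (squeeze_cvgr _ (cvg_cst 0) cvgK); near=> N.
rewrite var_ge0/=; apply: le_trans (bound _); last first.
  by near: N; exists 1%N.
by rewrite lerDl sqr_ge0.
Unshelve. all: by end_near. Qed.

Lemma mean_square_cvg_mean : mean P (X N) @[N --> \oo] --> b.
Proof.
apply/cvgrPdist_lt => e e0; near=> N.
rewrite -(@ltr_pXn2r _ 2)// ?nnegrE ?ltW// real_normK ?num_real//.
apply: (@le_lt_trans _ _ (K / N%:R)).
  rewrite -sqrrN opprB; apply: le_trans (bound _); last by near: N; exists 1%N.
  by rewrite lerDr var_ge0.
near: N; apply: cvgr_lt cvgK _ _; exact: exprn_gt0.
Unshelve. all: by end_near. Qed.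

End MeanSquareConvergence.

(** * Mean-square consistency of the maximum likelihood estimator *)

Section MLConsistency.
Context (R : realType) d (T : measurableType d) (P : probability T R).
Variables (a b : R) (nmax : nat) (n : option nat -> nat).
Hypotheses (a0 : 0 < a) (b0 : 0 < b).
Hypothesis hn : forall i, (1 <= n i <= nmax)%N.
Variables (rate : option nat -> {RV P >-> R})
  (y : option nat -> nat -> {RV P >-> nat}).
Hypothesis model : gamma_poisson_model a b n rate y.
Variable bML : nat -> T -> R.
Hypothesis hbML : forall N w, is_ml_estimate a N n
  (fun i => total_count n (fun i l => y i l : T -> nat) i w) (bML N w).

Let s w i : R := total_countR n y (Some i) w.
Let m i : R := (n (Some i))%:R.

Let s0 w i : 0 <= s w i. Proof. by rewrite /s /total_countR. Qed.

Let m1 i : 1 <= m i <= nmax%:R.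
Proof. by have /andP[h1 h2] := hn (Some i); rewrite ler1n h1 ler_nat. Qed.

Let bML_ge0 N w : 0 <= bML N w. Proof. by have [] := hbML N w. Qed.

Let bML_score N w : score a (s w) m N (bML N w) = 0.
Proof. exact: ml_estimate_score a0 (hbML N w). Qed.

Lemma bML0 : bML 0 = cst 0.
Proof. by apply/funext => w; have [_ _] := hbML 0 w; apply. Qed.

Lemma measurable_total_count i : measurable_fun setT (total_countR n y i : T -> R).
Proof.
have := total_count_Lfun2 a0 b0 model i.
by move=> /sub_Lfun_mfun; rewrite inE.
Qed.

Lemma measurable_bML N : measurable_fun setT (bML N).
Proof.
case: N => [|N]; first by rewrite bML0.
apply: (measurability _ (RGenOInfty.measurableE R)) => //.
move=> /= _ [_ [t ->] <-]; rewrite setTI.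
have [t0|t0] := leP 0 t; last first.
  rewrite (_ : _ @^-1` _ = setT)//; apply/seteqP; split => // w _ /=.
  by rewrite in_itv/= andbT (lt_le_trans t0).
(* The score at a fixed level is a finite sum of measurable functions. *)
rewrite (_ : _ @^-1` _ = (fun w => score a (s w) m N.+1 t) @^-1` `]0, +oo[).
  rewrite -[X in measurable X]setTI.
  suff : measurable_fun setT (fun w => score a (s w) m N.+1 t) by apply.
  apply: measurable_sum => i; apply: measurable_funM => //.
  by apply: measurable_funB => //; exact: measurable_total_count.
by apply/seteqP; split => w /=;
  rewrite !in_itv/= !andbT (@score_root_lt _ a (s w) m N.+1 a0 (s0 w) _ m1 _ t).
Qed.

Let v0 : R := a * (a + 1) * b ^+ 2 + a * b.
Let C1 : R := (nmax%:R * b + 1) * (nmax%:R * (2 * nmax%:R * b) + 1) / a.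
Let C2 : R := 2 * nmax%:R / a.
Let K : R := (C1 ^+ 2 + C2 ^+ 2) * (4 ^+ nmax * v0).
Let D (c : nat -> R) N w : R :=
  \sum_(i < N) c i *
    (total_countR n y (Some (i : nat)) w - (n (Some (i : nat)))%:R * (a * b)).

(** The pointwise bound integrated, with the weights 1 / (n_i b + 1) and
    1 / n_i. *)
Lemma bML_mean_square N : (0 < N)%N ->
  (\int[P]_w ((bML N w - b) ^+ 2)%:E <= (K / N%:R)%:E)%E.
Proof.
move=> N0; have N0' : 0 < N%:R :> R by rewrite ltr0n.
pose c1 i := (m i * b + 1)^-1; pose c2 i := (m i)^-1.
have m0 i : 0 < m i by have /andP[+ _] := m1 i; exact: lt_le_trans.
have c1_le i : `|c1 i| <= 1.
  have h : 1 <= m i * b + 1 by rewrite lerDr mulr_ge0 ?ltW.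
  by rewrite ger0_norm ?invr_ge0 ?invf_le1 ?(le_trans ler01 h)// (lt_le_trans ltr01 h).
have c2_le i : `|c2 i| <= 1.
  have /andP[h _] := m1 i.
  by rewrite ger0_norm ?invr_ge0 ?invf_le1 ?(ltW (m0 i)).
have mD c : measurable_fun setT (D c N).
  apply: measurable_sum => i; apply: measurable_funM => //.
  by apply: measurable_funB => //; exact: measurable_total_count.
have D0 (k : R) c w : (0 <= (k ^+ 2 / N%:R ^+ 2 * D c N w ^+ 2)%:E)%E.
  by rewrite lee_fin mulr_ge0 ?sqr_ge0// divr_ge0 ?sqr_ge0.
have mD2 (k : R) c :
    measurable_fun setT (fun w => (k ^+ 2 / N%:R ^+ 2 * D c N w ^+ 2)%:E).
  by apply/measurable_EFinP; apply: measurable_funM => //; exact: measurable_funX.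
have intD (k : R) c : (forall i, `|c i| <= 1) ->
    (\int[P]_w (k ^+ 2 / N%:R ^+ 2 * D c N w ^+ 2)%:E <=
     (k ^+ 2 * (4 ^+ nmax * v0) / N%:R)%:E)%E.
  move=> cle; under eq_integral do rewrite EFinM.
  rewrite ge0_integralZl//; last 3 first.
  - by apply/measurable_EFinP; exact: measurable_funX.
  - by move=> w _; rewrite lee_fin sqr_ge0.
  - by rewrite lee_fin divr_ge0 ?sqr_ge0.
  have -> : (k ^+ 2 * (4 ^+ nmax * v0) / N%:R)%:E =
      ((k ^+ 2 / N%:R ^+ 2)%:E * (N%:R * (4 ^+ nmax * v0))%:E)%E.
    by rewrite -EFinM; congr EFin; field; rewrite gt_eqF.
  apply: lee_wpmul2l; first by rewrite lee_fin divr_ge0 ?sqr_ge0.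
  exact: (weighted_deviation_sqr a0 b0 hn model N cle).
apply: (@le_trans _ _ (\int[P]_w ((C1 ^+ 2 / N%:R ^+ 2 * D c1 N w ^+ 2)%:E +
    (C2 ^+ 2 / N%:R ^+ 2 * D c2 N w ^+ 2)%:E))%E).
  apply: ge0_le_integral => //.
  - by move=> w _; rewrite lee_fin sqr_ge0.
  - apply/measurable_EFinP; apply: measurable_funX; apply: measurable_funB => //.
    exact: measurable_bML.
  - exact: emeasurable_funD.
  - move=> w _; rewrite -EFinD lee_fin.
    have := score_root_deviation a0 (s0 w) m1 b0 N0 (bML_ge0 N w) (bML_score N w).
    rewrite -ler_pdivlMr ?exprn_gt0// => /le_trans; apply.
    by rewrite mulrDl mulrAC [X in _ + X <= _]mulrAC.
rewrite ge0_integralD//; apply: (le_trans (leeD (intD C1 _ c1_le) (intD C2 _ c2_le))).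
by rewrite -EFinD lee_fin /K mulrDl mulrDl.
Qed.

(** For a positive number of agents, finiteness of the mean square suffices. *)
Lemma bML_Lfun2 N : bML N \in Lfun P 2%:E.
Proof.
case: N => [|N]; first by rewrite bML0 Lfun_cst.
have b2 : cst b \in Lfun P 2%:E by exact: Lfun_cst.
have Xb2 : bML N.+1 \- cst b \in Lfun P 2%:E.
  apply: Lfun2_sqr.
    by apply: measurable_funB => //; exact: measurable_bML.
  by apply: le_lt_trans (bML_mean_square (ltn0Sn N)) _; rewrite ltry.
rewrite (_ : bML N.+1 = (bML N.+1 \- cst b) \+ cst b).
  by rewrite rpredD ?lee1n.
by apply/funext => w /=; rewrite subrK.
Qed.

End MLConsistency.

(** * Limits of the Taylor approximations *)

Section EbFactor.
Context {R : realType}.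
Variable nj : nat.
Implicit Types s : R.

Let den_neq0 s : 0 < s -> 1 + nj%:R * s != 0.
Proof. by move=> s0; rewrite gt_eqF// ltr_wpDr// mulr_ge0// ltW. Qed.

Let is_derive_den s : is_derive s 1 (fun t : R => 1 + nj%:R * t) nj%:R.
Proof.
rewrite -[X in is_derive _ _ _ X]add0r.
apply: is_deriveD; rewrite -[X in is_derive _ _ _ X]mulr1.
exact: (@is_deriveZ _ _ _ _ (nj%:R : R) _ _ _ (is_derive_id _ _)).
Qed.

Lemma is_derive_eb_factor s : 0 < s ->
  is_derive s 1 (eb_factor nj) ((1 + nj%:R * s) ^- 2).
Proof.
move=> s0.
have h := @is_deriveM R R id (fun t : R => (1 + nj%:R * t)^-1) s 1 1 _ (is_derive_id _ _)
  (@is_deriveV R (fun t : R => 1 + nj%:R * t) s nj%:R 1 (den_neq0 s0) (is_derive_den s)).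
rewrite (_ : eb_factor nj = id * (fun t : R => (1 + nj%:R * t)^-1))//.
apply: (is_derive_eq h).
by rewrite /GRing.scale/=; field; exact: den_neq0.
Qed.

Lemma is_derive_eb_factor1 s : 0 < s ->
  is_derive s 1 (derive1 (eb_factor nj : R -> R)) (- 2 * nj%:R * (1 + nj%:R * s) ^- 3).
Proof.
move=> s0.
have dV := @is_deriveV R (fun t : R => 1 + nj%:R * t) s nj%:R 1 (den_neq0 s0)
  (is_derive_den s).
have h := @is_deriveX _ _ _ 2 _ _ _ dV.
(* The closed form of the first derivative holds at positive points, hence on
   a neighbourhood of [s], and not everywhere. *)
apply: (@near_eq_is_derive _ _ _ ((fun t : R => (1 + nj%:R * t)^-1) ^+ 2)).
  near=> t; have t0 : 0 < t by near: t; exact: lt_nbhsr.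
  rewrite derive1E (@derive_val _ _ _ _ _ _ _ (is_derive_eb_factor t0)).
  by rewrite -exprVn.
apply: (is_derive_eq h).
by rewrite /GRing.scale/=; field; exact: den_neq0.
Unshelve. all: by end_near. Qed.

Lemma eb_factor_derive1 s : 0 < s ->
  derive1 (eb_factor nj : R -> R) s = (1 + nj%:R * s) ^- 2.
Proof.
by move=> s0; rewrite derive1E (@derive_val _ _ _ _ _ _ _ (is_derive_eb_factor s0)).
Qed.

Lemma eb_factor_derive2 s : 0 < s ->
  derive1n 2 (eb_factor nj : R -> R) s = - 2 * nj%:R * (1 + nj%:R * s) ^- 3.
Proof.
move=> s0; rewrite derive1nS derive1n1 derive1E.
exact: (@derive_val _ _ _ _ _ _ _ (is_derive_eb_factor1 s0)).
Qed.

Section Cvg.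
Variables (b : R) (m : nat -> R).
Hypotheses (b0 : 0 < b) (mb : m @ \oo --> b).

Let m_gt0 : \forall N \near \oo, 0 < m N.
Proof. by apply: cvgr_gt mb _ b0. Qed.

Let cvg_den : (fun N => (1 + nj%:R * m N)^-1) @ \oo --> (1 + nj%:R * b)^-1.
Proof.
apply: cvgV; first exact: den_neq0.
by apply: cvgD; [exact: cvg_cst|exact: cvgMr].
Qed.

Lemma eb_factor_cvg : eb_factor nj (m N) @[N --> \oo] --> eb_factor nj b.
Proof. by apply: cvgM. Qed.

Lemma eb_factor_derive1_cvg :
  derive1 (eb_factor nj : R -> R) (m N) @[N --> \oo] --> (1 + nj%:R * b) ^- 2.
Proof.
apply: (cvg_trans (G := (fun N => (1 + nj%:R * m N)^-1 ^+ 2) @ \oo)).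
  apply: near_eq_cvg; near=> N; rewrite eb_factor_derive1; last by near: N.
  by rewrite exprVn.
rewrite -exprVn; have : continuous (fun z : R => z ^+ 2) by exact: exprn_continuous.
by move=> /(_ (1 + nj%:R * b)^-1); apply: cvg_comp.
Unshelve. all: by end_near. Qed.

Lemma eb_factor_derive2_cvg :
  derive1n 2 (eb_factor nj : R -> R) (m N) @[N --> \oo] -->
  - 2 * nj%:R * (1 + nj%:R * b) ^- 3.
Proof.
apply: (cvg_trans (G := (fun N => - 2 * nj%:R * (1 + nj%:R * m N)^-1 ^+ 3) @ \oo)).
  apply: near_eq_cvg; near=> N; rewrite eb_factor_derive2; last by near: N.
  by rewrite exprVn.
apply: cvgMr; rewrite -exprVn.
have : continuous (fun z : R => z ^+ 3) by exact: exprn_continuous.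
by move=> /(_ (1 + nj%:R * b)^-1); apply: cvg_comp.
Unshelve. all: by end_near. Qed.

End Cvg.
End EbFactor.

Section TaylorLimits.
Context d (T : measurableType d) (R : realType) (P : probability T R).
Variables (b : R) (X : nat -> T -> R).
Hypotheses (b0 : 0 < b) (meanX : mean P (X N) @[N --> \oo] --> b)
  (varX : var P (X N) @[N --> \oo] --> (0 : R)).

Lemma eb_mean_approx_cvg (a : R) nj lam :
  eb_mean_approx P a nj (X N) lam @[N --> \oo] -->
  b / (1 + nj%:R * b) * (a + nj%:R * lam).
Proof.
apply: cvgMl; rewrite -[X in _ --> X]addr0.
apply: cvgD; first exact: eb_factor_cvg.
rewrite -(mulr0 (2^-1 * (- 2 * nj%:R * (1 + nj%:R * b) ^- 3))).
apply: cvgM => //; apply: cvgMr; exact: eb_factor_derive2_cvg.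
Qed.

Lemma eb_var_approx_cvg (a : R) nj lam :
  eb_var_approx P a nj (X N) lam @[N --> \oo] -->
  (b / (1 + nj%:R * b)) ^+ 2 * (nj%:R * lam).
Proof.
rewrite -[X in _ --> X]addr0; apply: cvgD.
  apply: cvgMl; rewrite expr2; under eq_cvg do rewrite expr2.
  by apply: cvgM; exact: eb_factor_cvg.
rewrite -(mul0r (shifted_count_mean a nj lam ^+ 2 + shifted_count_var nj lam)).
apply: cvgMl; rewrite -(mulr0 ((1 + nj%:R * b) ^- 2 ^+ 2)).
apply: cvgM => //; rewrite expr2; under eq_cvg do rewrite expr2.
by apply: cvgM; exact: eb_factor_derive1_cvg.
Qed.

End TaylorLimits.

(** * The theorem *)

(* The first conjunct says that the mean and the variance of the maximum
   likelihood estimator exist, so that the approximations are meaningful. *)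
Theorem mainTheorem2 (R : realType) (d : measure_display)
    (T : measurableType d) (P : probability T R)
    (a b : R) (ha : 0 < a) (hb : 0 < b)
    (nmax : nat) (hnmax : (1 <= nmax)%N)
    (n : option nat -> nat) (hn : forall i, (1 <= n i <= nmax)%N)
    (rate : option nat -> {RV P >-> R})
    (y : option nat -> nat -> {RV P >-> nat})
    (model : gamma_poisson_model a b n rate y)
    (bML : nat -> T -> R)
    (hbML : forall N w, is_ml_estimate a N n
       (fun i => total_count n (fun i l => y i l : T -> nat) i w) (bML N w)) :
  let nj := n None in
  [/\ (forall N, bML N \in Lfun P 2%:E),
      (forall w, eb_mean_approx P a nj (bML N) (rate None w) @[N --> \oo] -->
         b / (1 + nj%:R * b) * (a + nj%:R * rate None w)) &
      (forall w, eb_var_approx P a nj (bML N) (rate None w) @[N --> \oo] -->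
         (b / (1 + nj%:R * b)) ^+ 2 * (nj%:R * rate None w))].
Proof.
have mc := @mean_square_cvg_mean _ _ _ _ _ _ _
  (bML_Lfun2 ha hb hn model hbML) (bML_mean_square ha hb hn model hbML).
have vc := @mean_square_cvg_var _ _ _ _ _ _ _
  (bML_Lfun2 ha hb hn model hbML) (bML_mean_square ha hb hn model hbML).
split=> [N|w|w].
- exact: (bML_Lfun2 ha hb hn model hbML).
- exact: (eb_mean_approx_cvg hb mc vc).
- exact: (eb_var_approx_cvg hb mc vc).
Qed.
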